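(* For any accepted sequence of $N$ batches, with residuals $r_0,\dots,r_N$, let $$\alpha_m=\frac{\underline G_m^{\mathrm{pool}}}{\|r_m\|_Y^2},\qquad \theta_m=\frac{\underline G_m^{\mathrm{sel}}}{\underline G_m^{\mathrm{pool}}}\qquad(0\le m<N)$$ be the computed lower coverage and retained-gain fractions. Then $$\|r_N\|_Y^2\le\|r_0\|_Y^2\prod_{m=0}^{N-1}(1-\alpha_m\theta_m).$$ If $\alpha_m\ge\alpha_0>0$ and $\theta_m\ge\theta_0>0$ until $\|r_m\|_Y\le\tau$, the required number $N$ of accepted batches satisfies $$N\le\left\lceil\frac{\log(\|r_0\|_Y^2/\tau^2)}{-\log(1-\alpha_0\theta_0)}\right\rceil .$$ If batch $m$ adds $d_m$ quotient coordinates and costs $\kappa_m$, the certified representation dimension and the accumulated refinement work are $\dim V_0+\sum_{m<N}d_m$ and $\sum_{m<N}\kappa_m$, respectively.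
   Context: $X,Y$ are Hilbert spaces (trial and test), $T:X\to Y$ is a bounded linear operator (the trial-to-test operator), $g\in Y$, and $V_0\subset V_1\subset\cdots\subset V_N\subset X$ are finite-dimensional trial spaces. For each $m$, $u_m$ minimizes $\|g-Tv\|_Y$ over $V_m$, $r_m=g-Tu_m$ and $Z_m=T(V_m)$; $P_W$ denotes $Y$-orthogonal projection onto $W$. At stage $m<N$ there is a finite certified pool of candidate blocks $C:E_C\to X$ (linear maps on finite-dimensional coefficient spaces). The innovation of a block is $Q_C=(I-P_{Z_m})(T\circ C)$, and the joint operator-image innovation of the pool is $W_m=\sum_C Q_C(E_C)\subset Z_m^\perp$. The number $\underline G_m^{\mathrm{pool}}$ is a positive computed lower bound for the exact aggregate pool gain $\|P_{W_m}r_m\|_Y^2$. The accepted batch $\mathcal B_m$ is a subfamily of the pool, $V_{m+1}=V_m+\sum_{C\in\mathcal B_m}C(E_C)$, and $\underline G_m^{\mathrm{sel}}$ is its certified gain, that is, a computed lower bound for the exact squared residual reduction: $\underline G_m^{\mathrm{sel}}\le\|r_m\|_Y^2-\|r_{m+1}\|_Y^2$, with $0<\theta_m\le1$. The number $\tau>0$ is the residual tolerance, and the required number of batches is the number needed to reach $\|r_N\|_Y\le\tau$. Quotient coordinates of a batch are the coordinates remaining after coefficients in the kernel of its joint innovation map (those representing no new operator-visible function relative to $V_m$) have been identified with zero; $d_m$ is their number and $\kappa_m$ is the cost assigned to batch $m$.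
   Formalization: The bound on the required number N is stated for α_0θ_0 < 1 (else the logarithm is undefined) and τ ≤ ‖r_0‖; if ‖r_0‖ < τ the printed ceiling can be negative while N = 0 (e.g. ‖r_0‖ = 1, τ = 10, α_0 = θ_0 = 1/2), so N = 0 is stated instead. *)

(* Defs.v *)
From HB Require Import structures.
From mathcomp Require Export all_boot all_order all_algebra.
From mathcomp Require Export complex.
From mathcomp Require Export all_classical all_reals all_analysis.
Export Order.TTheory GRing.Theory Num.Theory numFieldNormedType.Exports.

Set Implicit Arguments.
Unset Strict Implicit.
Unset Printing Implicit Defensive.

Global Open Scope classical_set_scope.
Global Open Scope ring_scope.

(* Hilbert spaces are real or complex: the scalar field is R or R[i].  *)
Variant scalar_kind := RealScalars | ComplexScalars.

Definition scalars (R : realType) (k : scalar_kind) : numFieldType :=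
  match k with RealScalars => R | ComplexScalars => R[i] end.

Definition scalar_conj (R : realType) (k : scalar_kind) :
    scalars R k -> scalars R k :=
  match k return scalars R k -> scalars R k with
  | RealScalars => fun x => x
  | ComplexScalars => fun z => conjc z
  end.

Definition scalar_re (R : realType) (k : scalar_kind) : scalars R k -> R :=
  match k return scalars R k -> R with
  | RealScalars => fun x => x
  | ComplexScalars => fun z => complex.Re z
  end.

(* The inner product is linear in its first argument and conjugate-linear in
   its second one; completeness is that of the underlying normed module. *)
Record hilbert (R : realType) (k : scalar_kind) := Hilbert {
  hilbert_sort :> completeNormedModType (scalars R k);
  inner : {dot hilbert_sort for @scalar_conj R k};
  inner_normE : forall x : hilbert_sort, inner x x = `|x| ^+ 2 }.

(* Norms of a normed module lie in its scalar field; hnorm is the same norm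
   as an element of R. *)
Definition hnorm (R : realType) (k : scalar_kind) (H : hilbert R k) (x : H) : R :=
  scalar_re (`|x|).

Section Dimension.
Variables (K : fieldType) (E : lmodType K).

Definition lincomb n (e : 'I_n -> E) (c : 'rV[K]_n) : E :=
  \sum_(i < n) c 0 i *: e i.

Definition sum_set (A B : set E) : set E := [set a + b | a in A & b in B].

Definition has_dim (V : set E) (n : nat) : Prop :=
  exists e : 'I_n -> E, range (lincomb e) = V /\ injective (lincomb e).

Definition finite_dim (V : set E) : Prop := exists n, has_dim V n.

(* 0 for a set that is not a finite-dimensional subspace. *)
Definition dimension (V : set E) : nat := xget 0%N [set n | has_dim V n].

End Dimension.

Section Projection.
Variables (R : realType) (k : scalar_kind) (H : hilbert R k).

Definition is_oproj (W : set H) (y p : H) : Prop :=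
  W p /\ forall w, W w -> inner H (y - p) w = 0.

(* Orthogonal projection onto W; 0 when y has no projection onto W, which does
   not happen if W is a finite-dimensional subspace. *)
Definition oproj (W : set H) (y : H) : H := xget 0 [set p | is_oproj W y p].

End Projection.

Section LeastSquares.
Variables (R : realType) (k : scalar_kind) (X Y : hilbert R k).
Variables (T : {linear X -> Y}) (g : Y).

Definition is_minimizer (V : set X) (u : X) : Prop :=
  V u /\ forall v, V v -> hnorm (g - T u) <= hnorm (g - T v).

End LeastSquares.

Section Blocks.
Variables (R : realType) (k : scalar_kind) (X Y : hilbert R k).
Let K : numFieldType := scalars R k.

Record block := Block {
  coef : vectType K;
  block_map :> {linear coef -> X} }.

Variables (T : {linear X -> Y}) (Z : set Y).

Definition innovation (C : block) (e : coef C) : Y :=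
  T (C e) - oproj Z (T (C e)).

Variables (I : finType) (C : I -> block).

Definition coefs : Type := forall i, coef (C i).

Definition batch_map (B : {set I}) (f : coefs) : X := \sum_(i in B) C i (f i).

Definition joint_innovation (B : {set I}) (f : coefs) : Y :=
  \sum_(i in B) innovation (f i).

Definition pool_innovation : set Y := range (joint_innovation [set: I]).

(* The classes of e 0, ..., e (d - 1) are a basis of the coefficient space of
   the batch B modulo the kernel of its joint innovation map. Members of coefs
   also have entries outside B: they do not affect joint_innovation B, so the
   quotient is the same as for coefficients indexed by B only. *)
Definition quotient_coordinates (B : {set I}) d (e : 'I_d -> coefs) : Prop :=
  forall f : coefs, exists! c : 'rV[K]_d,
    joint_innovation B (fun i => f i - \sum_(j < d) c 0 j *: e j i) = 0.

End Blocks.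

Section Representation.
Variables (R : realType) (k : scalar_kind) (X : hilbert R k).
Variables (V0 : set X) (I : nat -> finType).
Variables (C : forall m, I m -> block X) (B : forall m, {set I m}).
Variables (d : nat -> nat) (e : forall m, 'I_(d m) -> coefs (@C m)).

(* Trial functions represented after n batches: the coefficients of each batch
   are taken modulo the kernel of its joint innovation map, so that a batch
   contributes only its quotient coordinates. *)
Fixpoint representation_space (n : nat) : set X :=
  if n is m.+1 then
    sum_set (representation_space m)
            (range (lincomb (fun j => batch_map (B m) (@e m j))))
  else V0.

End Representation.

Fixpoint total_work (R : realType) (kappa : nat -> R) (n : nat) : R :=
  if n is m.+1 then total_work kappa m + kappa m else 0.

(* n is the first index at which the residual norm is at most tau. *)
Definition required_batches (R : realType) (k : scalar_kind) (Y : hilbert R k)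
    (r : nat -> Y) (tau : R) (n : nat) : Prop :=
  hnorm (r n) <= tau /\ forall m, (m < n)%N -> tau < hnorm (r m).

(* Main.v *)
From HB Require Import structures.
Require Import Defs.

Set Implicit Arguments.
Unset Strict Implicit.
Unset Printing Implicit Defensive.

(** Accepting batch [m] lowers the squared residual by at least its certified
    gain [Gsel m], which is the fraction
    [Gsel m / hnorm (r m) ^+ 2 = alpha m * theta m] of its current value;
    multiplying these contractions gives the product bound. The one delicate
    point is that [alpha m] must be a genuine quotient: a zero residual has zero
    projection onto every set ([oproj0]), hence zero pool gain, which the
    positive certificate [Gpool m] excludes.

    For the count, as long as the residual exceeds [tau] each contraction factor
    is at most [q = 1 - alow * tlow], so [tau ^+ 2 < hnorm (r 0) ^+ 2 * q ^+ n]
    if the residuals up to index [n] all exceed [tau]. Taking logarithms makes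
    [n] strictly smaller than the ceiling ([geometric_decay_count]). Applied to
    the index before the first success this bounds the required number;
    applied to [N] it shows that success occurs once [N] reaches the ceiling.

    For the dimension, the vectors contributed by a batch in quotient
    coordinates are independent modulo the current trial space [V m]
    ([quotient_coordinates_free]): if a combination of them lies in [V m], its
    joint innovation lies in [Z m = T @` V m] and is also orthogonal to [Z m], so
    it vanishes, and uniqueness of quotient coordinates makes the combination
    trivial. Since the represented space after [m] batches is contained in [V m],
    each batch adds exactly [d m] dimensions ([has_dim_sum]). [T] may have a
    kernel on [V 0]: independence is tested on the new vectors only. *)

(** * Finite-dimensional subspaces given by linear combinations *)

Section LinearCombinations.
Variables (K : fieldType) (E : lmodType K).

Lemma lincomb_is_linear n (b : 'I_n -> E) : linear (lincomb b).
Proof.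
move=> a c c'; rewrite /lincomb scaler_sumr -big_split /=.
by apply: eq_bigr => i _; rewrite !mxE scalerDl scalerA.
Qed.

HB.instance Definition _ n (b : 'I_n -> E) :=
  GRing.isLinear.Build K 'rV[K]_n E _ (lincomb b) (@lincomb_is_linear n b).

Lemma finite_dim_lin (V : set E) a x y :
  finite_dim V -> V x -> V y -> V (a *: x + y).
Proof.
by move=> [n [b [<- _]]] [c _ <-] [c' _ <-]; exists (a *: c + c'); rewrite // linearP.
Qed.

Lemma finite_dim0 (V : set E) : finite_dim V -> V 0.
Proof. by move=> [n [b [<- _]]]; exists 0; rewrite // linear0. Qed.

(** A vector family whose nontrivial combinations avoid [U] is free modulo [U],
    so appending it to a basis of [U] gives a basis of the sum. *)
Lemma has_dim_sum (U : set E) n p (b : 'I_p -> E) :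
  has_dim U n -> (forall c, U (lincomb b c) -> c = 0) ->
  has_dim (sum_set U (range (lincomb b))) (n + p).
Proof.
move=> [a [<- a_inj]] b_free.
pose ab (i : 'I_(n + p)) := match fintype.split i with inl j => a j | inr j => b j end.
have abE c : lincomb ab c = lincomb a (lsubmx c) + lincomb b (rsubmx c).
  rewrite /lincomb big_split_ord /=; congr (_ + _); apply: eq_bigr => i _.
    by rewrite mxE /ab (unsplitK (inl i)).
  by rewrite mxE /ab (unsplitK (inr i)).
exists ab; split.
  apply/seteqP; split=> x /=.
    move=> [c _ <-]; exists (lincomb a (lsubmx c)); first by exists (lsubmx c).
    by exists (lincomb b (rsubmx c)); [exists (rsubmx c) | rewrite abE].
  move=> [_ [c _ <-] [_ [c' _ <-] <-]]; exists (row_mx c c') => //.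
  by rewrite abE row_mxKl row_mxKr.
apply: raddf_inj => c /=; rewrite abE => /eqP; rewrite addr_eq0 => /eqP ab0.
have cr0 : rsubmx c = 0.
  by apply: b_free; exists (- lsubmx c); rewrite // linearN /= ab0 opprK.
have cl0 : lsubmx c = 0 by apply: a_inj; rewrite ab0 cr0 !linear0.
by rewrite -[c]hsubmxK cl0 cr0 row_mx0.
Qed.

End LinearCombinations.

(** * Orthogonal projections onto finite-dimensional spans *)

Section OrthogonalProjection.
Variables (R : realType) (k : scalar_kind) (H : hilbert R k).
Implicit Types (W : set H) (x y : H).

Lemma inner_self_eq0 (x : H) : inner H x x = 0 -> x = 0.
Proof. by move/eqP; rewrite inner_normE expf_eq0 normr_eq0 => /eqP. Qed.

(** Valid for any set [W]: a projection [p] of [0] is orthogonal to itself, and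
    the default value of [oproj] is [0] as well. *)
Lemma oproj0 W : oproj W 0 = 0.
Proof.
rewrite /oproj; case: xgetP => // p _ [Wp /(_ p Wp)].
by rewrite sub0r linearNl => /eqP; rewrite oppr_eq0 => /eqP /inner_self_eq0.
Qed.

(** Gram-Schmidt, one vector at a time: with [w] the component of the last vector
    orthogonal to the previous span, the projection onto the larger span is the
    old projection plus the component along [w]. No independence is assumed, so
    that the lemma applies to the image of a basis under a noninjective map. *)
Lemma span_oproj n (b : 'I_n -> H) y :
  exists p, is_oproj (range (lincomb b)) y p.
Proof.
elim: n => [|n IHn] in b y *.
  exists 0; split; first by exists 0; rewrite // linear0.
  by move=> _ [c _ <-]; rewrite /lincomb big_ord0 linear0r.
pose b' i := b (widen_ord (leqnSn n) i); set v := b ord_max.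
have bE c : lincomb b c
    = lincomb b' (\row_i c 0 (widen_ord (leqnSn n) i)) + c 0 ord_max *: v.
  by rewrite /lincomb big_ord_recr /=; congr (_ + _); apply: eq_bigr => i _; rewrite mxE.
have [p [[cp _ pE] p_orth]] := IHn b' y.
have [q [[cq _ qE] q_orth]] := IHn b' v.
pose w := v - q.
have [a aw] : exists a, a * inner H w w = inner H (y - p) w.
  exists (inner H (y - p) w / inner H w w).
  (* If [w] is null, both sides vanish and the default value of division is harmless. *)
  have [w0|w_neq0] := eqVneq (inner H w w) 0; last by rewrite divfK.
  by rewrite w0 mulr0 (inner_self_eq0 w0) linear0r.
exists (p + a *: w); split.
  pose c i := if unlift ord_max i is Some j then (cp - a *: cq) 0 j else a.
  exists (\row_i c i) => //; rewrite bE.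
  have -> : \row_i (\row_i c i) 0 (widen_ord (leqnSn n) i) = cp - a *: cq.
    apply/rowP => i; rewrite !mxE /c.
    have -> : widen_ord (leqnSn n) i = lift ord_max i.
      by apply: val_inj; rewrite /= /bump leqNgt ltn_ord.
    by rewrite liftK !mxE.
  rewrite mxE /c unlift_none linearB linearZ /= pE qE /w scalerBr.
  by rewrite -addrA [- _ + _]addrC.
(* Test vectors split along the old span and [w], so orthogonality to each suffices. *)
move=> _ [c _ <-]; rewrite bE; set z := lincomb b' _.
have -> : z + c 0 ord_max *: v = (z + c 0 ord_max *: q) + c 0 ord_max *: w.
  by rewrite /w scalerBr -addrA [_ *: q + _]addrC subrK.
have Wz : range (lincomb b') (z + c 0 ord_max *: q).
  by rewrite -qE -linearZ -linearD; eexists.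
have -> : y - (p + a *: w) = - a *: w + (y - p).
  by rewrite opprD addrA scaleNr addrC.
rewrite linearDr linearZr_LR 2!linearPl /= p_orth // q_orth //.
by rewrite -aw !mulNr addNr !mulr0 oppr0 !addr0.
Qed.

End OrthogonalProjection.

(** * Quotient coordinates are independent modulo the trial space *)

Section QuotientCoordinates.
Variables (R : realType) (k : scalar_kind) (X Y : hilbert R k).
Variables (T : {linear X -> Y}) (I : finType) (C : I -> block X).
Implicit Types (V : set X) (B : {set I}) (f : coefs C).

Lemma batch_map_lincomb B d (e : 'I_d -> coefs C) (c : 'rV_d) :
  batch_map B (fun i => \sum_(j < d) c 0 j *: e j i)
  = lincomb (fun j => batch_map B (e j)) c.
Proof.
rewrite /batch_map /lincomb; under eq_bigr do rewrite linear_sum.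
rewrite exchange_big; apply: eq_bigr => j _; rewrite scaler_sumr.
by apply: eq_bigr => i _; rewrite linearZ.
Qed.

Lemma image_oproj V y : finite_dim V -> is_oproj (T @` V) y (oproj (T @` V) y).
Proof.
move=> [n [b [VE _]]]; apply: xgetPex; have [p pP] := span_oproj (T \o b) y.
suff -> : T @` V = range (lincomb (T \o b)) by exists p.
have TE c : T (lincomb b c) = lincomb (T \o b) c.
  by rewrite /lincomb linear_sum; apply: eq_bigr => i _; rewrite linearZ.
by rewrite -VE image_comp; congr (_ @` _); apply/funext => c /=; rewrite TE.
Qed.

(** The joint innovation is the image of [batch_map B f] minus projections onto
    [T @` V]; when that image itself lies in [T @` V], so does the innovation,
    which is then orthogonal to itself. *)
Lemma joint_innovation_eq0 V B f :
  finite_dim V -> V (batch_map B f) -> joint_innovation T (T @` V) B f = 0.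
Proof.
move=> fV Vf; set J := joint_innovation _ _ _ _.
have VZ (z : Y) : (T @` V) z -> inner Y J z = 0.
  move=> Vz; rewrite /J linear_sumlz big1 // => i _.
  by have [_ orth] := image_oproj (T (C i (f i))) fV; apply: orth.
apply/inner_self_eq0/VZ.
have [v [Vv vE]] : exists v, V v /\ T v = \sum_(i in B) oproj (T @` V) (T (C i (f i))).
  elim/big_ind: _ => [|x y [v [Vv <-]] [w [Vw <-]]|i _].
  - by exists 0; rewrite linear0; split; first exact: finite_dim0.
  - exists (v + w); rewrite linearD; split => //.
    by rewrite -[v]scale1r; apply: finite_dim_lin.
  - by have [[v Vv <-] _] := image_oproj (T (C i (f i))) fV; exists v.
exists (- 1 *: v + batch_map B f); first exact: finite_dim_lin.
by rewrite linearP vE scaleN1r addrC /batch_map linear_sum /J -sumrB.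
Qed.

(** If a combination with coefficients [c] lies in [V], both [c] and [0] represent
    the zero class of the quotient, so that they coincide. *)
Lemma quotient_coordinates_free V B d (e : 'I_d -> coefs C) (c : 'rV_d) :
  finite_dim V -> quotient_coordinates T (T @` V) B e ->
  V (lincomb (fun j => batch_map B (e j)) c) -> c = 0.
Proof.
move=> fV eP Vc; have [c0 [_ c0_uniq]] := eP (fun=> 0).
have coord c' : V (lincomb (fun j => batch_map B (e j)) c') -> c0 = c'.
  move=> Vc'; apply/c0_uniq/joint_innovation_eq0 => //.
  rewrite /batch_map; under eq_bigr do rewrite sub0r linearN.
  rewrite sumrN -/(batch_map B (fun i => \sum_j c' 0 j *: e j i)).
  rewrite batch_map_lincomb -scaleN1r -[_ *: _]addr0.
  by apply: finite_dim_lin => //; apply: finite_dim0.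
rewrite -(coord c Vc); apply: coord; rewrite linear0; exact: finite_dim0.
Qed.

End QuotientCoordinates.

(** * Real-valued norms *)

Section Norm.
Variables (R : realType) (k : scalar_kind).

Lemma scalar_re_ge0 (a : scalars R k) : 0 <= a -> 0 <= scalar_re a.
Proof. by case: k a => //= -[x y]; rewrite lecE /= => /andP[]. Qed.

Lemma scalar_re_eq0 (a : scalars R k) : 0 <= a -> scalar_re a = 0 -> a = 0.
Proof. by case: k a => //= -[x y]; rewrite lecE /= => /andP[/eqP -> _] ->. Qed.

Variable H : hilbert R k.

Lemma hnorm_ge0 (x : H) : 0 <= hnorm x.
Proof. exact: scalar_re_ge0. Qed.

Lemma hnorm0 : hnorm (0 : H) = 0.
Proof. by rewrite /hnorm normr0; case: k. Qed.

Lemma hnorm_eq0 (x : H) : hnorm x = 0 -> x = 0.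
Proof. by move=> x0; apply/eqP; rewrite -normr_eq0; apply/eqP/scalar_re_eq0. Qed.

End Norm.

(** * Geometric decay of a real sequence *)

Section Decay.
Variable R : realType.

Lemma prod_decay (x c : nat -> R) n :
  (forall m, (m < n)%N -> 0 <= c m) ->
  (forall m, (m < n)%N -> x m.+1 <= x m * c m) ->
  x n <= x 0%N * \prod_(m < n) c m.
Proof.
elim: n => [|n IHn] c_ge0 step; first by rewrite big_ord0 mulr1.
rewrite big_ord_recr /= mulrA (le_trans (step n _)) ?ler_wpM2r ?c_ge0 //.
by apply: IHn => m mn; [apply: c_ge0 | apply: step]; apply: ltnW.
Qed.

(** Taking logarithms of the hypothesis gives [n * - ln q < ln (x0 / t)]; the
    inequality is strict, hence so is the comparison with the ceiling. *)
Lemma geometric_decay_count (x0 t q : R) n :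
  0 < t -> 0 < q < 1 -> t < x0 * q ^+ n ->
  n%:Z < Num.ceil (ln (x0 / t) / - ln q).
Proof.
move=> t_gt0 q01 lt_t; have [q_gt0 _] := andP q01.
have qn_gt0 : 0 < q ^+ n by rewrite exprn_gt0.
have x0_gt0 : 0 < x0 by rewrite -(pmulr_lgt0 _ qn_gt0) (lt_trans t_gt0).
rewrite ceil_gt_int ltr_pdivlMr ?oppr_gt0 ?ln_lt0 // ln_div ?posrE //.
rewrite mulrN -[n%:~R]/(n%:R) mulr_natl -lnXn // ltrBrDr addrC -ltrBrDr opprK.
by rewrite -lnM ?posrE // ltr_ln ?posrE // mulr_gt0.
Qed.

End Decay.

(** * Contraction, batch count and certified dimension *)

Theorem corollary3p6
  (R : realType) (k : scalar_kind) (X Y : hilbert R k)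
  (T : {linear X -> Y}) (T_bounded : bounded_near T (nbhs (0 : X))) (g : Y)
  (N : nat)
  (V : nat -> set X)
  (V_findim : forall m, (m <= N)%N -> finite_dim (V m))
  (V_nested : forall m, (m < N)%N -> V m `<=` V m.+1)
  (u : nat -> X)
  (u_min : forall m, (m <= N)%N -> is_minimizer T g (V m) (u m))
  (r : nat -> Y) (rE : forall m, (m <= N)%N -> r m = g - T (u m))
  (Z : nat -> set Y) (ZE : forall m, (m <= N)%N -> Z m = T @` V m)
  (I : nat -> finType) (C : forall m, I m -> block X)
  (W : nat -> set Y)
  (WE : forall m, (m < N)%N -> W m = pool_innovation T (Z m) (@C m))
  (B : forall m, {set I m})
  (V_step : forall m, (m < N)%N ->
     V m.+1 = sum_set (V m) (range (batch_map (C := @C m) (B m))))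
  (Gpool Gsel : nat -> R)
  (Gpool_gt0 : forall m, (m < N)%N -> 0 < Gpool m)
  (Gpool_le : forall m, (m < N)%N -> Gpool m <= hnorm (oproj (W m) (r m)) ^+ 2)
  (Gsel_le : forall m, (m < N)%N ->
     Gsel m <= hnorm (r m) ^+ 2 - hnorm (r m.+1) ^+ 2)
  (alpha theta : nat -> R)
  (alphaE : forall m, (m < N)%N -> alpha m = Gpool m / hnorm (r m) ^+ 2)
  (thetaE : forall m, (m < N)%N -> theta m = Gsel m / Gpool m)
  (theta_range : forall m, (m < N)%N -> 0 < theta m <= 1)
  (d : nat -> nat) (e : forall m, 'I_(d m) -> coefs (@C m))
  (e_coord : forall m, (m < N)%N ->
     quotient_coordinates T (Z m) (B m) (@e m))
  (kappa : nat -> R) :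
  [/\ hnorm (r N) ^+ 2 <=
        hnorm (r 0%N) ^+ 2 * \prod_(m < N) (1 - alpha m * theta m),
      (* alow, tlow are the uniform lower bounds of the two fractions;
         alow * tlow < 1 is needed for the logarithm to be defined *)
      forall tau alow tlow : R,
        0 < tau -> 0 < alow -> 0 < tlow -> alow * tlow < 1 ->
        (forall m, (m < N)%N -> tau < hnorm (r m) ->
           alow <= alpha m /\ tlow <= theta m) ->
        let Nmax := Num.ceil (ln (hnorm (r 0%N) ^+ 2 / tau ^+ 2)
                              / - ln (1 - alow * tlow)) in
        (forall n, (n <= N)%N -> required_batches r tau n ->
           (tau <= hnorm (r 0%N) -> n%:Z <= Nmax) /\
           (hnorm (r 0%N) < tau -> n = 0%N)) /\
        (Nmax <= N%:Z -> exists2 n, (n <= N)%N & required_batches r tau n),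
      has_dim (representation_space (V 0%N) B e N)
        (dimension (V 0%N) + \sum_(m < N) d m)%N
    & total_work kappa N = \sum_(m < N) kappa m].
Proof.
pose x m := hnorm (r m) ^+ 2.
have x_gt0 m : (m < N)%N -> 0 < x m.
  move=> mN; rewrite exprn_gt0 // lt_neqAle hnorm_ge0 andbT eq_sym.
  apply/eqP => /hnorm_eq0 r0; have := lt_le_trans (Gpool_gt0 m mN) (Gpool_le m mN).
  by rewrite r0 oproj0 hnorm0 expr0n ltxx.
have atE m : (m < N)%N -> alpha m * theta m = Gsel m / x m.
  move=> mN; rewrite alphaE // thetaE // [LHS]mulrC mulrA divfK ?gt_eqF //.
  exact: Gpool_gt0.
have step m : (m < N)%N -> x m.+1 <= x m * (1 - alpha m * theta m).
  move=> mN; rewrite mulrBr mulr1 atE // mulrCA divff ?gt_eqF ?x_gt0 // mulr1.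
  by rewrite lerBrDr -lerBrDl Gsel_le.
(* A factor cannot be negative, as it bounds a ratio of squared norms. *)
have factor_ge0 m : (m < N)%N -> 0 <= 1 - alpha m * theta m.
  move=> mN; rewrite -(pmulr_rge0 _ (x_gt0 m mN)) (le_trans _ (step m mN)) //.
  exact: sqr_ge0.
split.
- exact: (prod_decay (x := x) (c := fun m => 1 - alpha m * theta m)).
- move=> tau alow tlow tau_gt0 alow_gt0 tlow_gt0 q_lt1 low.
  set q := 1 - alow * tlow; move=> Nmax.
  have q01 : 0 < q < 1 by rewrite subr_gt0 q_lt1 gtrBl mulr_gt0.
  have tau_sqr n : (tau < hnorm (r n)) = (tau ^+ 2 < x n).
    by rewrite ltr_pXn2r // nnegrE ?hnorm_ge0 ?ltW.
  have count n : (n <= N)%N -> (forall m, (m <= n)%N -> tau < hnorm (r m)) ->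
      n%:Z < Nmax.
    move=> nN above; apply: geometric_decay_count; rewrite ?exprn_gt0 //.
    have := above n (leqnn n); rewrite tau_sqr => /lt_le_trans; apply.
    rewrite -[n in q ^+ n]card_ord -prodr_const.
    apply: (@prod_decay _ x (fun=> q)) => m mn; first by case/andP: q01 => /ltW.
    have mN := leq_trans mn nN; have [] := low m mN (above m (ltnW mn)) => al tl.
    apply: le_trans (step m mN) _; rewrite ler_pM2l ?x_gt0 // lerB //.
    by rewrite ler_pM // ltW.
  split.
    move=> [|n] nN [_ above]; split=> // r0_tau.
    (* Success at index [0]: the quotient of logarithms is nonnegative. *)
    + have [q_gt0 q_lt] := andP q01.
      rewrite ceil_ge0 (lt_le_trans (ltrN10 _)) // divr_ge0 //.
        rewrite ln_ge0 // ler_pdivlMr ?exprn_gt0 // mul1r.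
        by rewrite ler_pXn2r // nnegrE ?hnorm_ge0 ?ltW.
      by rewrite oppr_ge0 ltW ?ln_lt0.
    (* Index [n] is the last one before success, whence [n.+1 <= Nmax]. *)
    + rewrite -addn1 PoszD lezD1; apply: count => //; exact: ltnW.
    + by have := lt_trans r0_tau (above 0%N isT); rewrite ltxx.
  move=> Nmax_le; have [n [nN n_le]] : exists n, (n <= N)%N /\ hnorm (r n) <= tau.
    apply: contrapT => none; suff : N%:Z < Nmax by rewrite ltNge Nmax_le.
    apply: count => // m mN; rewrite ltNge; apply/negP => m_le.
    by apply: none; exists m.
  have exn : exists n, hnorm (r n) <= tau by exists n.
  case: (ex_minnP exn) => n0 n0_le n0_min; exists n0.
    exact: leq_trans (n0_min n n_le) nN.
  split=> // m mn0; rewrite ltNge; apply/negP => /n0_min.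
  by rewrite leqNgt mn0.
- have rep_sub n : (n <= N)%N -> representation_space (V 0%N) B e n `<=` V n.
    elim: n => [_ //|n IHn nN _ [v Vv [_ [c _ <-] <-]]].
    rewrite V_step //; exists v; first exact: IHn (ltnW nN) _ Vv.
    rewrite -batch_map_lincomb; set w := batch_map _ _.
    by exists w; first by eexists.
  have : (N <= N)%N by [].
  elim: {-2}N => [|n IHn] nN.
    rewrite big_ord0 addn0; exact: (xgetPex 0%N (V_findim 0%N isT)).
  rewrite big_ord_recr addnA /=; apply: has_dim_sum (IHn (ltnW nN)) _ => c Rc.
  have := e_coord n nN; rewrite ZE; last exact: ltnW.
  move=> /(quotient_coordinates_free (V_findim n (ltnW nN))); apply.
  exact: rep_sub (ltnW nN) _ Rc.
- elim: (N) => [|n IHn]; first by rewrite big_ord0.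
  by rewrite big_ord_recr /= IHn.
Qed.
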